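(* Let $\Phi\in\mathcal{LP}(\mathbb{I},\mathbb{R}^n)$ admit an EMD on $\mathbb{I}$. Then $$\theta:=\operatorname{dist}(\{0\},\Sigma^{\mathbb{I}}(\Phi))$$ is a positive real number, and it is the largest number such that any $\Psi\in\mathcal{LP}(\mathbb{I},\mathbb{R}^n)$ with $\tilde d_{\mathbb{I}}(\Phi,\Psi)<\theta$ admits an EMD on $\mathbb{I}$.
   Context: Let $n\ge 1$, let $|\cdot|$ be an arbitrary fixed norm on $\mathbb{R}^n$ with unit sphere $\mathcal{S}$ and induced operator norm $\|\cdot\|$. Let $\mathbb{I}\subset\mathbb{R}$ be compact (not necessarily an interval), $t_-=\min\mathbb{I}$, $t_+=\max\mathbb{I}$, $t_-<t_+$. Put $\mathbb{I}^2_{\neq}=\{(t,s)\in\mathbb{I}\times\mathbb{I}: t\neq s\}$ and let $\overline{\mathbb{I}^2_{\neq}}$ be its closure in $\mathbb{R}^2$. A linear process on $\mathbb{I}$ is a family $\Phi(t,s)\in GL(n,\mathbb{R})$, $t,s\in\mathbb{I}$, such that $(t,s,x)\mapsto\Phi(t,s)x$ is continuous, $\Phi(t,t)=\mathrm{id}$, $\Phi(t,s)\Phi(s,r)=\Phi(t,r)$ for all $t,s,r\in\mathbb{I}$, and $t\mapsto\Phi(t,s)$ is Lipschitz continuous in operator norm for every $s\in\mathbb{I}$. For continuous $f:\mathbb{I}\to(0,\infty)$ let $\Delta(f)(t,s)=\frac{\ln f(t)-\ln f(s)}{t-s}$, $(t,s)\in\mathbb{I}^2_{\neq}$. Standing assumption: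 $\mathcal{LP}(\mathbb{I},\mathbb{R}^n)$ denotes the set of linear processes $\Phi$ on $\mathbb{I}$ for which $(x,t,s)\mapsto\Delta(|\Phi(\cdot,t_-)x|)(t,s)$ extends continuously from $\mathcal{S}\times\mathbb{I}^2_{\neq}$ to $\mathcal{S}\times\overline{\mathbb{I}^2_{\neq}}$; the extension is denoted by the same symbol. $\mathrm{Gr}(k,\mathbb{R}^n)$ is the set of $k$-dimensional subspaces of $\mathbb{R}^n$. For a subspace $X\neq\{0\}$, $\underline{\lambda}(X,\Phi)$ and $\overline{\lambda}(X,\Phi)$ are the minimum and the maximum, respectively, of $\Delta(|\Phi(\cdot,t_-)x|)(t,s)$ over $x\in X\cap\mathcal{S}$, $(t,s)\in\overline{\mathbb{I}^2_{\neq}}$. Extremal growth rates: for $k\in\{1,\ldots,n\}$, $\underline{\lambda}_k(\Phi)=\max_{X\in\mathrm{Gr}(k,\mathbb{R}^n)}\underline{\lambda}(X,\Phi)$ and $\overline{\lambda}_k(\Phi)=\min_{X\in\mathrm{Gr}(k,\mathbb{R}^n)}\overline{\lambda}(X,\Phi)$; $\underline{\lambda}_0(\Phi)=\infty$, $\overline{\lambda}_0(\Phi)=-\infty$. $\Phi$ admits an exponential monotonicity dichotomy (EMD) on $\mathbb{I}$ if there is $k\in\{0,\ldots,n\}$ with $\overline{\lambda}_k(\Phi)<0<\underline{\lambda}_{n-k}(\Phi)$. For $\gamma\in\mathbb{R}$ put $\Phi_\gamma(t,s)=e^{-\gamma(t-s)}\Phi(t,s)$. The (finite-time dichotomy) spectrum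 is $\Sigma^{\mathbb{I}}(\Phi)=\{\gamma\in\mathbb{R}:\Phi_\gamma\text{ does not admit an EMD on }\mathbb{I}\}$. Semimetric: $\tilde d_{\mathbb{I}}(\Phi,\Psi)=\sup_{X\in\mathrm{Gr}(1,\mathbb{R}^n)}\max\{|\underline{\lambda}(X,\Phi)-\underline{\lambda}(X,\Psi)|,|\overline{\lambda}(X,\Phi)-\overline{\lambda}(X,\Psi)|\}$. *)

(* Defs.v *)
From HB Require Import structures.
From mathcomp Require Import all_boot all_order all_algebra.
From mathcomp Require Import all_classical all_reals all_analysis.

Set Implicit Arguments.
Unset Strict Implicit.
Unset Printing Implicit Defensive.

Import Order.TTheory GRing.Theory Num.Theory.
Import numFieldNormedType.Exports.

Local Open Scope classical_set_scope.
Local Open Scope ring_scope.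

(* An arbitrary norm on R^n = 'cV[R]_n. The topology used on 'cV[R]_n is the
   canonical (sup-norm) one, which every such norm induces. *)
Record is_norm (R : realType) (n : nat) (N : 'cV[R]_n -> R) : Prop := IsNorm {
  is_norm_ge0 : forall x, 0 <= N x ;
  is_norm_eq0 : forall x, N x = 0 -> x = 0 ;
  is_normZ : forall (a : R) x, N (a *: x) = `|a| * N x ;
  is_normD : forall x y, N (x + y) <= N x + N y }.

Definition usphere (R : realType) (n : nat) (N : 'cV[R]_n -> R) :
  set 'cV[R]_n := [set x | N x = 1].

Definition opnorm (R : realType) (n : nat) (N : 'cV[R]_n -> R)
  (A : 'M[R]_n) : R := sup [set N (A *m x) | x in usphere N].

(* Attained minimum and maximum of a set of reals (0 if there is none). *)
Definition minimum (R : realType) (A : set R) : R := xget 0 (A `&` lbound A).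
Definition maximum (R : realType) (A : set R) : R := xget 0 (A `&` ubound A).

Definition offdiag (R : realType) (I : set R) : set (R * R) :=
  [set p | [/\ I p.1, I p.2 & p.1 <> p.2]].

(* A process is a total function Phi of two real times, of which only the
   values Phi t s with t and s in I are ever used. *)
Definition linear_process (R : realType) (n : nat) (N : 'cV[R]_n -> R)
  (I : set R) (Phi : R -> R -> 'M[R]_n) : Prop :=
  [/\ forall t s, I t -> I s -> Phi t s \in unitmx,
      {within (I `*` I) `*` [set: 'cV[R]_n],
         continuous (fun p : (R * R) * 'cV[R]_n =>
                       Phi p.1.1 p.1.2 *m p.2 : 'cV[R]_n)},
      forall t, I t -> Phi t t = 1%:M,
      forall t s r, I t -> I s -> I r -> Phi t s *m Phi s r = Phi t r
    & forall s, I s -> exists L : R, forall t t', I t -> I t' ->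
        opnorm N (Phi t s - Phi t' s) <= L * `|t - t'|].

Definition log_quotient (R : realType) (f : R -> R) (t s : R) : R :=
  (ln (f t) - ln (f s)) / (t - s).

Definition growth (R : realType) (n : nat) (N : 'cV[R]_n -> R)
  (I : set R) (Phi : R -> R -> 'M[R]_n) (p : 'cV[R]_n * (R * R)) : R :=
  log_quotient (fun t => N (Phi t (minimum I) *m p.1)) p.2.1 p.2.2.

Definition growth_extension (R : realType) (n : nat) (N : 'cV[R]_n -> R)
  (I : set R) (Phi : R -> R -> 'M[R]_n) (g : 'cV[R]_n * (R * R) -> R) : Prop :=
  {within usphere N `*` closure (offdiag I), continuous g} /\
  (forall p, (usphere N `*` offdiag I) p -> g p = growth N I Phi p).

Definition LP (R : realType) (n : nat) (N : 'cV[R]_n -> R) (I : set R) :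
  set (R -> R -> 'M[R]_n) :=
  [set Phi | linear_process N I Phi /\
             exists g, growth_extension N I Phi g].

(* The extension is unique on usphere N `*` closure (offdiag I), the only place
   where ext_growth is evaluated. *)
Definition ext_growth (R : realType) (n : nat) (N : 'cV[R]_n -> R)
  (I : set R) (Phi : R -> R -> 'M[R]_n) : 'cV[R]_n * (R * R) -> R :=
  xget (fun=> 0) [set g | growth_extension N I Phi g].

Definition growth_values (R : realType) (n : nat) (N : 'cV[R]_n -> R)
  (I : set R) (Phi : R -> R -> 'M[R]_n) (X : {vspace 'cV[R]_n}) : set R :=
  [set ext_growth N I Phi p |
     p in ([set x | x \in X] `&` usphere N) `*` closure (offdiag I)].

Definition lower_growth (R : realType) (n : nat) (N : 'cV[R]_n -> R)
  (I : set R) (Phi : R -> R -> 'M[R]_n) (X : {vspace 'cV[R]_n}) : R :=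
  minimum (growth_values N I Phi X).

Definition upper_growth (R : realType) (n : nat) (N : 'cV[R]_n -> R)
  (I : set R) (Phi : R -> R -> 'M[R]_n) (X : {vspace 'cV[R]_n}) : R :=
  maximum (growth_values N I Phi X).

Definition Gr (R : realType) (n k : nat) : set {vspace 'cV[R]_n} :=
  [set X | \dim X = k].
Arguments Gr : clear implicits.

Definition lower_rate (R : realType) (n : nat) (N : 'cV[R]_n -> R)
  (I : set R) (Phi : R -> R -> 'M[R]_n) (k : nat) : \bar R :=
  if k == 0%N then +oo%E
  else (maximum [set lower_growth N I Phi X | X in Gr R n k])%:E.

Definition upper_rate (R : realType) (n : nat) (N : 'cV[R]_n -> R)
  (I : set R) (Phi : R -> R -> 'M[R]_n) (k : nat) : \bar R :=
  if k == 0%N then -oo%E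
  else (minimum [set upper_growth N I Phi X | X in Gr R n k])%:E.

Definition EMD (R : realType) (n : nat) (N : 'cV[R]_n -> R)
  (I : set R) (Phi : R -> R -> 'M[R]_n) : Prop :=
  exists k : nat, [/\ (k <= n)%N,
    (upper_rate N I Phi k < 0)%E & (0 < lower_rate N I Phi (n - k))%E].

Definition shifted (R : realType) (n : nat) (gamma : R)
  (Phi : R -> R -> 'M[R]_n) : R -> R -> 'M[R]_n :=
  fun t s => expR (- gamma * (t - s)) *: Phi t s.

Definition spectrum (R : realType) (n : nat) (N : 'cV[R]_n -> R)
  (I : set R) (Phi : R -> R -> 'M[R]_n) : set R :=
  [set gamma | ~ EMD N I (shifted gamma Phi)].

Definition semidist (R : realType) (n : nat) (N : 'cV[R]_n -> R)
  (I : set R) (Phi Psi : R -> R -> 'M[R]_n) : \bar R :=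
  ereal_sup [set (Num.max
      `|lower_growth N I Phi X - lower_growth N I Psi X|
      `|upper_growth N I Phi X - upper_growth N I Psi X|)%:E | X in Gr R n 1].

Definition EMD_radius (R : realType) (n : nat) (N : 'cV[R]_n -> R)
  (I : set R) (Phi : R -> R -> 'M[R]_n) (r : R) : Prop :=
  forall Psi, LP N I Psi -> (semidist N I Phi Psi < r%:E)%E -> EMD N I Psi.

(* Main.v *)
Require Import Defs.
From HB Require Import structures.
From mathcomp Require Import all_boot all_order all_algebra.
From mathcomp Require Import all_classical all_reals all_analysis.
From mathcomp Require Import ring lra.
Import Order.TTheory GRing.Theory Num.Theory.
Import numFieldNormedType.Exports.
Local Open Scope classical_set_scope.
Local Open Scope ring_scope.

Set Implicit Arguments.
Unset Strict Implicit.
Unset Printing Implicit Defensive.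

(** Write [g] for the continuously extended growth function of [Phi] and [Q] for
    the closure of the off-diagonal. The extremal rates are optima over
    Grassmannians of minima and maxima of [g]. As Grassmannians are compact these
    optima are attained ([best_lower_subspace], [best_upper_subspace]), so a
    dichotomy means that there are subspaces [X] and [Y] of complementary
    dimensions such that [g < 0] on the unit vectors of [X] and [g > 0] on those
    of [Y] ([EMD_splitting]). Shifting by [gamma] replaces [g] by [g - gamma]
    ([ext_growth_shifted]), so [gamma] lies outside the spectrum exactly when [X]
    and [Y] can be chosen with [g < gamma] on [X] and [g > gamma] on [Y]
    ([spectrumP]).

    Take [X] and [Y] optimal for their dimensions, with [g <= - d < 0] on [X] and
    [g >= c > 0] on [Y]. All of the open interval from [- d] to [c] is split by
    [X] and [Y]. Its endpoints belong to the spectrum, by optimality and because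
    subspaces whose dimensions add up to more than [n] meet
    ([best_upper_no_splitting], [best_lower_no_splitting]). Hence the distance
    [theta] from 0 to the spectrum is the smaller of [c] and [d]; if [X] or [Y]
    is trivial, only the other number exists ([splitting_gap]).

    If [Psi] is closer to [Phi] than [theta], then on each line in [X] its upper
    rate is less than [- theta + theta = 0], and on each line in [Y] its lower
    rate is positive, so the same [X] and [Y] give a dichotomy of [Psi]
    ([splitting_perturbation]). No larger radius is possible: for a spectral value [gamma] with [`|gamma| = theta], the
    shifted process has no dichotomy and is at distance at most [theta] from
    [Phi] ([semidist_shifted]). *)

(** * Matrices and arbitrary norms *)

Lemma linear_mx_continuous (R : realType) (m n : nat) (V : normedModType R)
  (f : {linear 'M[R]_(m, n) -> V}) : continuous f.
Proof.
have -> : f = (fun A : 'M[R]_(m, n) =>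
    \sum_(i < m) \sum_(j < n) A i j *: f (delta_mx i j)) :> (_ -> _).
  apply/funext => A; rewrite {1}(matrix_sum_delta A) linear_sum.
  by apply: eq_bigr => i _; rewrite linear_sum; apply: eq_bigr => j _; rewrite linearZ.
move=> A; apply: cvg_big; [exact: add_continuous|exact: nbhs_filter|move=> i _].
apply: cvg_big; [exact: add_continuous|exact: nbhs_filter|move=> j _].
by apply: cvgZr_tmp; [exact: nbhs_filter|exact: (@coord_continuous _ _ _ i j A)].
Qed.

Lemma entry_le_norm (R : realType) (m n : nat) (A : 'M[R]_(m, n)) i j :
  `|A i j| <= `|A|.
Proof.
rewrite [leRHS]/Num.norm /= mx_normrE.
exact: (le_bigmax 0 (fun ij : 'I_m * 'I_n => `|A ij.1 ij.2|) (i, j)).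
Qed.

(** Heine-Borel for matrices, transported from row vectors by [vec_mx]. *)
Lemma closed_entries_bounded_compact (R : realType) (m n : nat) (M : R)
  (K : set 'M[R]_(m, n)) :
  closed K -> (forall A, K A -> forall i j, `|A i j| <= M) -> compact K.
Proof.
move=> cK KM.
have cB : compact [set v : 'rV[R]_(m * n) | forall k, `[- M, M]%classic (v ord0 k)].
  by apply: (@rV_compact _ _ (fun=> `[- M, M]%classic)) => _; exact: segment_compact.
apply: (subclosed_compact cK (continuous_compact _ cB)).
  by apply: continuous_subspaceT; exact: (@linear_mx_continuous R 1 (m * n) _ vec_mx).
move=> A KA; exists (mxvec A); last exact: mxvecK.
move=> k /=; case/mxvec_indexP: k => i j.
by rewrite mxvecE in_itv /= -ler_norml; exact: KM.
Qed.

Lemma is_norm0 (R : realType) (n : nat) (N : 'cV[R]_n -> R) : is_norm N -> N 0 = 0.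
Proof. by move=> hN; rewrite -(scale0r 0) (is_normZ hN) normr0 mul0r. Qed.

Lemma norm_bound (R : realType) (n : nat) (N : 'cV[R]_n -> R) : is_norm N ->
  exists2 C : R, 0 <= C & forall x, N x <= C * `|x|.
Proof.
move=> hN.
have Nsum (I : finType) (F : I -> 'cV[R]_n) : N (\sum_i F i) <= \sum_i N (F i).
  elim/big_ind2 : _ => [|x a y b xa yb|//]; first by rewrite is_norm0.
  by apply: le_trans (is_normD hN _ _) _; exact: lerD.
exists (\sum_(i < n) N (delta_mx i 0)).
  by apply: sumr_ge0 => i _; exact: is_norm_ge0.
move=> x; rewrite {1}(matrix_sum_delta x).
apply: le_trans (Nsum _ _) _; rewrite mulr_suml; apply: ler_sum => i _.
rewrite big_ord1 (is_normZ hN) mulrC ler_wpM2l ?(is_norm_ge0 hN)//.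
exact: entry_le_norm.
Qed.

Lemma is_norm_gt0 (R : realType) (n : nat) (N : 'cV[R]_n -> R) x : is_norm N ->
  x != 0 -> 0 < N x.
Proof.
move=> hN x0; rewrite lt0r (is_norm_ge0 hN) andbT.
by apply: contra x0 => /eqP/(is_norm_eq0 hN)->.
Qed.

Lemma is_norm_dist (R : realType) (n : nat) (N : 'cV[R]_n -> R) x y : is_norm N ->
  `|N x - N y| <= N (x - y).
Proof.
move=> hN; rewrite ler_norml; apply/andP; split; last first.
  by have := is_normD hN (x - y) y; rewrite subrK => h; rewrite lerBlDr.
have := is_normD hN (y - x) x; rewrite subrK.
rewrite -opprB -scaleN1r (is_normZ hN) normrN1 mul1r => h.
by rewrite lerNl opprB lerBlDr.
Qed.

Lemma is_norm_continuous (R : realType) (n : nat) (N : 'cV[R]_n -> R) :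
  is_norm N -> continuous N.
Proof.
move=> hN x; have [C C0 NC] := norm_bound hN.
apply/(@cvgrPdist_lt _ _ _ (nbhs x) _ N (N x)) => e e0; near=> y.
apply: le_lt_trans (is_norm_dist _ _ hN) _; apply: le_lt_trans (NC _) _.
apply: (@le_lt_trans _ _ ((C + 1) * `|x - y|)); first by rewrite ler_wpM2r// lerDl.
rewrite -ltr_pdivlMl ?ltr_wpDl//.
near: y; apply: (@cvgr_dist_lt _ _ _ (nbhs x)) => //.
by rewrite mulr_gt0 ?invr_gt0 ?ltr_wpDl.
Unshelve. all: by end_near. Qed.

(** Together with [norm_bound] this says that [N] is equivalent to the sup norm:
    the constant is the minimum of [N] on the compact sup-norm sphere. *)
Lemma mx_norm_le (R : realType) (n : nat) (N : 'cV[R]_n -> R) : is_norm N ->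
  exists2 c : R, 0 < c & forall x, c * `|x| <= N x.
Proof.
move=> hN; pose K := [set x : 'cV[R]_n | `|x| = 1].
have cK : compact K.
  apply: (@closed_entries_bounded_compact _ _ _ 1).
    apply: (@preimage_closed _ _ (fun x : 'cV[R]_n => `|x|) [set 1]).
      by move=> x _; exact: norm_continuous.
    exact: closed_eq.
  by move=> x Kx i j; rewrite (le_trans (entry_le_norm _ _ _))// Kx.
have [K0|K0] := eqVneq K set0.
  (* An empty sup-norm sphere forces n = 0, where any constant will do. *)
  exists 1 => // x; have [->|x0] := eqVneq x 0; first by rewrite normr0 mulr0 is_norm_ge0.
  have : K (`|x|^-1 *: x).
    by rewrite /K /= normrZ normfV normr_id mulVf// normr_eq0.
  by rewrite K0.
have [|c Kc cmin] := compact_EVT_min _ cK (continuous_subspaceT (is_norm_continuous hN)).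
  exact/set0P.
rewrite inE in Kc.
exists (N c).
  apply: is_norm_gt0 => //; apply/eqP => c0; move: Kc; rewrite /K /= c0 normr0 => /eqP.
  by rewrite eq_sym oner_eq0.
move=> x; have [->|x0] := eqVneq x 0; first by rewrite normr0 mulr0 is_norm_ge0.
have nx : 0 < `|x| by rewrite normr_gt0.
rewrite -ler_pdivlMr// mulrC.
suff -> : `|x|^-1 * N x = N (`|x|^-1 *: x).
  by apply: cmin; rewrite inE /K /= normrZ normfV normr_id mulVf// gt_eqF.
by rewrite (is_normZ hN) ger0_norm// invr_ge0.
Qed.

Lemma usphere_compact (R : realType) (n : nat) (N : 'cV[R]_n -> R) : is_norm N ->
  compact (usphere N).
Proof.
move=> hN; have [c c0 cN] := mx_norm_le hN.
apply: (@closed_entries_bounded_compact _ _ _ c^-1).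
  apply: (@preimage_closed _ _ N [set 1]); last exact: closed_eq.
  by move=> x _; exact: is_norm_continuous.
move=> x Nx i j; apply: le_trans (entry_le_norm _ _ _) _.
by rewrite -[leRHS]mul1r ler_pdivlMr// mulrC -Nx.
Qed.

Lemma normalize_usphere (R : realType) (n : nat) (N : 'cV[R]_n -> R) x :
  is_norm N -> x != 0 -> usphere N ((N x)^-1 *: x).
Proof.
move=> hN x0; rewrite /usphere /= (is_normZ hN) ger0_norm ?invr_ge0 ?is_norm_ge0//.
by rewrite mulVf// gt_eqF// is_norm_gt0.
Qed.

Lemma usphere_neq0 (R : realType) (n : nat) (N : 'cV[R]_n -> R) x :
  is_norm N -> usphere N x -> x != 0.
Proof.
move=> hN Nx; apply/eqP => x0; move: Nx; rewrite /usphere /= x0 is_norm0//.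
by move=> /eqP; rewrite eq_sym oner_eq0.
Qed.

(** A supremum only bounds a set that is bounded above; here boundedness comes
    from compactness of the sphere. *)
Lemma opnorm_ub (R : realType) (n : nat) (N : 'cV[R]_n -> R) (A : 'M[R]_n) x :
  is_norm N -> usphere N x -> N (A *m x) <= opnorm N A.
Proof.
move=> hN Nx.
have [||c _ cmax] := @compact_EVT_max _ _ (fun x => N (A *m x)) (usphere N) _
   (usphere_compact hN).
- by exists x.
- apply: continuous_subspaceT => y.
  apply: (@continuous_comp _ _ _ (mulmx A) N); last exact: is_norm_continuous.
  exact: (@linear_mx_continuous _ _ _ _ (mulmx A)).
apply: ub_le_sup; last by exists x.
by exists (N (A *m c)) => _ [y Ny <-]; apply: cmax; rewrite inE.
Qed.

Lemma opnorm_le (R : realType) (n : nat) (N : 'cV[R]_n -> R) (A : 'M[R]_n) M :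
  (exists x, usphere N x) ->
  (forall x, usphere N x -> N (A *m x) <= M) -> opnorm N A <= M.
Proof.
move=> [x Nx] AM; apply: ge_sup; first by exists (N (A *m x)); exists x.
by move=> _ [y Ny <-]; exact: AM.
Qed.

(** * Compactness of the Grassmannian *)

Lemma vspace_closed (R : realType) (n : nat) (X : {vspace 'cV[R]_n}) :
  closed [set x | x \in X].
Proof.
have -> : [set x | x \in X] = (fun x => `|projv X x - x|) @^-1` [set 0].
  apply/seteqP; split=> x /=; first by move=> /projv_id ->; rewrite subrr normr0.
  by move=> /normr0_eq0/subr0_eq <-; exact: memv_proj.
apply: preimage_closed; last exact: closed_eq.
move=> x _; apply: (@continuous_comp _ _ _ (fun x => projv X x - x) Num.norm).
  apply: (@continuousB _ _ _ (projv X : 'cV[R]_n -> 'cV[R]_n) id) => //.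
  have h := @linear_mx_continuous R n 1 'cV[R]_n (projv X). exact: h.
exact: norm_continuous.
Qed.

Lemma row_dot_self_eq0 (R : realType) (n : nat) (v : 'cV[R]_n) :
  (v^T *m v) 0 0 = 0 -> v = 0.
Proof.
rewrite mxE => h; apply/matrixP => i j; rewrite ord1 mxE.
move: h => /eqP; rewrite psumr_eq0 => [/allP /(_ i)|k _]; rewrite mxE -expr2 ?sqr_ge0//.
by rewrite sqrf_eq0 mem_index_enum => /(_ isT)/eqP.
Qed.

(** Gram-Schmidt, one column at a time. The next column is found by counting
    dimensions: inside [X], the kernel of [A^T] is nonzero as long as [A] has
    fewer than [\dim X] columns. Every [k] up to [\dim X] is allowed, so the
    lemma also produces the [k]-dimensional subspaces of a given subspace. *)
Lemma orthonormal_frame_sub (R : realType) (n : nat) (X : {vspace 'cV[R]_n}) k :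
  (k <= \dim X)%N ->
  exists A : 'M[R]_(n, k), A^T *m A = 1%:M /\ forall c : 'cV_k, A *m c \in X.
Proof.
elim: k => [_|k IH kX].
  exists 0; split; first by rewrite flatmx0; apply/esym; rewrite flatmx0.
  by move=> c; rewrite mul0mx mem0v.
have [A [AA AX]] := IH (ltnW kX).
pose f : 'Hom('cV[R]_n, 'cV[R]_k) := linfun (mulmx A^T).
have : vpick (X :&: lker f)%VS != 0.
  rewrite vpick0 -dimv_eq0 -lt0n.
  have := limg_ker_dim f X; have := dimvS (subvf (f @: X)%VS).
  rewrite dimvf /dim /= muln1 => fk fX.
  by rewrite -(ltn_add2r (\dim (f @: X))) add0n fX (leq_ltn_trans fk).
set v := vpick _ => v0.
have /memv_capP[vX vf] : v \in (X :&: lker f)%VS by exact: memv_pick.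
have Av : A^T *m v = 0 by move: vf; rewrite memv_ker lfunE /= => /eqP.
pose d := (v^T *m v) 0 0.
have d0 : 0 < d.
  rewrite lt_def; apply/andP; split; first by apply: contra v0 => /eqP/row_dot_self_eq0->.
  by rewrite /d mxE; apply: sumr_ge0 => i _; rewrite mxE -expr2 sqr_ge0.
have vv : v^T *m v = d%:M by rewrite [LHS]mx11_scalar.
pose u := (Num.sqrt d)^-1 *: v.
have uu : u^T *m u = 1%:M.
  have -> : u^T = (Num.sqrt d)^-1 *: v^T by apply/matrixP => i j; rewrite !mxE.
  rewrite /u -scalemxAl -scalemxAr vv scalerA -invfM -expr2 sqr_sqrtr ?ltW//.
  by rewrite scale_scalar_mx mulVf// gt_eqF.
have Au : A^T *m u = 0 by rewrite /u -scalemxAr Av scaler0.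
exists (row_mx u A : 'M[R]_(n, 1 + k)); split.
  suff h : (row_mx u A)^T *m row_mx u A = 1%:M :> 'M[R]_(1 + k)%N by exact: h.
  rewrite tr_row_mx mul_col_row uu AA Au.
  have -> : u^T *m A = 0 by rewrite -(trmxK A) -trmx_mul Au trmx0.
  by rewrite -scalar_mx_block.
move=> c; have := mul_row_col u A (@usubmx _ 1 k 1 c) (@dsubmx _ 1 k 1 c).
rewrite (@vsubmxK _ 1 k 1 c) => ->; rewrite memvD//.
by rewrite (mx11_scalar (usubmx _)) mul_mx_scalar !memvZ.
Qed.

Lemma frame_range_dim (R : realType) (n k : nat) (A : 'M[R]_(n, k)) :
  A^T *m A = 1%:M -> \dim (limg (linfun (mulmx A : 'cV[R]_k -> 'cV[R]_n))) = k.
Proof.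
move=> AA; rewrite limg_dim_eq ?dimvf /dim /= ?muln1// capfv; apply/eqP/lker0P => x y.
by rewrite !lfunE /= => /(congr1 (mulmx A^T)); rewrite !mulmxA AA !mul1mx.
Qed.

Lemma orthonormal_frames_compact (R : realType) (n k : nat) :
  compact [set A : 'M[R]_(n, k) | A^T *m A = 1%:M].
Proof.
apply: (@closed_entries_bounded_compact _ _ _ 1).
  have -> : [set A : 'M[R]_(n, k) | A^T *m A = 1%:M] =
     \bigcap_(ij in [set: 'I_k * 'I_k])
       (fun A => \sum_l A l ij.1 * A l ij.2) @^-1` [set (ij.1 == ij.2)%:R].
    apply/seteqP; split=> A /=.
      move=> AA [i j] _ /=; have := congr1 (fun B : 'M[R]_k => B i j) AA.
      by rewrite !mxE => <-; apply: eq_bigr => l _; rewrite mxE.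
    move=> h; apply/matrixP => i j; rewrite !mxE -(h (i, j) I).
    by apply: eq_bigr => l _; rewrite mxE.
  apply: closed_bigI => -[i j] _ /=.
  apply: (@preimage_closed _ _ (fun A : 'M[R]_(n, k) => \sum_l A l i * A l j)
    [set (i == j)%:R]); last exact: closed_eq.
  move=> A _; apply: cvg_big; [exact: add_continuous|exact: nbhs_filter|move=> l _].
  apply: (@cvgM _ _ (nbhs A)); exact: (@coord_continuous _ _ _ _ _ A).
move=> A /= AA i j; have := congr1 (fun B : 'M[R]_k => B j j) AA.
rewrite !mxE eqxx mulr1n (bigD1 i)//= mxE -expr2 => h.
rewrite -(@expr_le1 _ 2)// real_normK ?num_real// -h lerDl.
by apply: sumr_ge0 => l _; rewrite mxE -expr2 sqr_ge0.
Qed.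

(** This is all that is used of the compactness of the Grassmannian. Choose an
    orthonormal frame for each of the given subspaces; a cluster point of these
    frames is again orthonormal, and its range lies in every [C j], because for
    each coefficient vector [c] the condition [C j (A *m c)] is closed in [A].
    The columns must be orthonormal so that the limit keeps rank [k]. *)
Lemma subspace_in_closed_bigcap (R : realType) (n k : nat) (C : nat -> set 'cV[R]_n) :
  (forall j, closed (C j)) -> (forall i j, (i <= j)%N -> C j `<=` C i) ->
  (forall j, exists2 X : {vspace 'cV[R]_n}, \dim X = k & [set x | x \in X] `<=` C j) ->
  exists2 X : {vspace 'cV[R]_n}, \dim X = k & forall j, [set x | x \in X] `<=` C j.
Proof.
move=> Ccl Cmono exX.
have exA j : exists A : 'M[R]_(n, k), A^T *m A = 1%:M /\ forall c : 'cV_k, C j (A *m c).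
  have [X Xk XC] := exX j.
  have [|A [AA AX]] := @orthonormal_frame_sub _ _ X k; first by rewrite Xk.
  by exists A; split => // c; exact: XC (AX c).
have [A_ A_P] := choice exA.
have [|A [AA clA]] := @orthonormal_frames_compact R n k (A_ @ \oo) _.
  by exists 0 => // j _; have [] := A_P j.
exists (limg (linfun (mulmx A : 'cV[R]_k -> 'cV[R]_n))); first exact: frame_range_dim.
move=> j _ /memv_imgP[c _ ->]; rewrite lfunE /=.
have Dcl : closed ((fun B : 'M[R]_(n, k) => B *m c) @^-1` C j).
  apply: preimage_closed => // B _.
  exact: (@linear_mx_continuous _ _ _ _ (mulmxr c)).
apply: Dcl; move: clA; rewrite clusterE; apply.
by exists j => // i /= ji; apply: (Cmono _ _ ji); have [_] := A_P i; apply.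
Qed.

(** * Extremal values over subspaces *)

Lemma maximumE (R : realType) (A : set R) x : A x -> ubound A x -> maximum A = x.
Proof.
move=> Ax Aub; apply: (@xget_unique _ 0 (A `&` ubound A)); first by [].
by move=> y [Ay yub]; apply/eqP; rewrite eq_le Aub// yub.
Qed.

Lemma minimumE (R : realType) (A : set R) x : A x -> lbound A x -> minimum A = x.
Proof.
move=> Ax Alb; apply: (@xget_unique _ 0 (A `&` lbound A)); first by [].
by move=> y [Ay ylb]; apply/eqP; rewrite eq_le Alb// ylb.
Qed.

(** Holds also when nothing is attained: both sides are then the default 0. *)
Lemma maximum_oppE (R : realType) (A : set R) :
  maximum [set - x | x in A] = - minimum A.
Proof.
rewrite /minimum; case: xgetP => [m _ [Am mlb]|noM].
  apply: maximumE; first by exists m.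
  by move=> _ [x Ax <-]; rewrite lerN2 mlb.
rewrite oppr0 /maximum; case: xgetP => // M _ [[x Ax <-] xub].
by case: (noM x); split => // y Ay; rewrite -lerN2 xub//; exists y.
Qed.

(** [growth_values], with the growth function as a parameter: statements about
    minima can then be applied to [- g], which need not be the growth of any
    process, to give the statements about maxima. *)
Definition values_on (R : realType) (n : nat) (N : 'cV[R]_n -> R) (Q : set (R * R))
  (g : 'cV[R]_n * (R * R) -> R) (X : {vspace 'cV[R]_n}) : set R :=
  [set g p | p in ([set x | x \in X] `&` usphere N) `*` Q].

Lemma values_on_opp (R : realType) (n : nat) (N : 'cV[R]_n -> R) (Q : set (R * R))
  (g : 'cV[R]_n * (R * R) -> R) (X : {vspace 'cV[R]_n}) :
  values_on N Q (fun p => - g p) X = [set - y | y in values_on N Q g X].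
Proof. by rewrite /values_on -image_comp. Qed.

Lemma values_on_minimumP (R : realType) (n : nat) (N : 'cV[R]_n -> R)
  (Q : set (R * R)) (g : 'cV[R]_n * (R * R) -> R) (X : {vspace 'cV[R]_n}) :
  is_norm N -> compact Q -> Q !=set0 -> {within usphere N `*` Q, continuous g} ->
  (0 < \dim X)%N ->
  values_on N Q g X (minimum (values_on N Q g X)) /\
  lbound (values_on N Q g X) (minimum (values_on N Q g X)).
Proof.
move=> hN cQ [q Qq] cg X0.
pose D := ([set x | x \in X] `&` usphere N) `*` Q.
have cD : compact D.
  apply: compact_setX => //; apply: (subclosed_compact _ (usphere_compact hN)).
    apply: closedI; first exact: vspace_closed.
    by apply: compact_closed; [exact: norm_hausdorff|exact: usphere_compact].
  by move=> x [].
have [||p Dp pmin] := @compact_EVT_min _ _ g D _ cD.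
- exists ((N (vpick X))^-1 *: vpick X, q); split=> //; split=> /=.
    by rewrite memvZ// memv_pick.
  by apply: normalize_usphere => //; rewrite vpick0 -dimv_eq0 -lt0n.
- by apply: continuous_subspaceW cg => -[x r] [[_ ?] ?].
rewrite inE in Dp.
have h : values_on N Q g X (g p) by exists p.
have h' : lbound (values_on N Q g X) (g p).
  by move=> _ [r Dr <-]; apply: pmin; rewrite inE.
by rewrite (minimumE h h').
Qed.

Lemma minimum_values_on_opp (R : realType) (n : nat) (N : 'cV[R]_n -> R)
  (Q : set (R * R)) (g : 'cV[R]_n * (R * R) -> R) (X : {vspace 'cV[R]_n}) :
  minimum (values_on N Q (fun p => - g p) X) = - maximum (values_on N Q g X).
Proof.
rewrite -[LHS]opprK -maximum_oppE -values_on_opp.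
by congr (- maximum (values_on _ _ _ _)); apply/funext => p; rewrite opprK.
Qed.

Lemma values_on_maximumP (R : realType) (n : nat) (N : 'cV[R]_n -> R)
  (Q : set (R * R)) (g : 'cV[R]_n * (R * R) -> R) (X : {vspace 'cV[R]_n}) :
  is_norm N -> compact Q -> Q !=set0 -> {within usphere N `*` Q, continuous g} ->
  (0 < \dim X)%N ->
  values_on N Q g X (maximum (values_on N Q g X)) /\
  ubound (values_on N Q g X) (maximum (values_on N Q g X)).
Proof.
move=> hN cQ Q0 cg X0.
have cNg : {within usphere N `*` Q, continuous (fun p => - g p)}.
  by move=> p; apply: continuousN; exact: cg.
have [] := values_on_minimumP hN cQ Q0 cNg X0.
rewrite minimum_values_on_opp values_on_opp => -[y Vy /oppr_inj <-] lb; split => // z Vz.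
by rewrite -lerN2; apply: lb; exists z.
Qed.

Lemma near_neq0 (R : realType) (n : nat) (x : 'cV[R]_n) :
  x != 0 -> \forall y \near nbhs x, y != 0.
Proof.
move=> x0; have := @cvgr_neq0 _ _ _ (nbhs x) _ id x (@cvg_id _ (nbhs x)) x0.
by apply.
Qed.

(** Normalizing extends [g (_, q)] from the sphere to all nonzero vectors, so
    that conditions on subspaces become closed conditions on the whole space. *)
Lemma normalized_value_continuous (R : realType) (n : nat) (N : 'cV[R]_n -> R)
  (Q : set (R * R)) (g : 'cV[R]_n * (R * R) -> R) q x :
  is_norm N -> {within usphere N `*` Q, continuous g} -> Q q -> x != 0 ->
  {for x, continuous (fun y => g ((N y)^-1 *: y, q))}.
Proof.
move=> hN /subspace_continuousP cg Qq x0.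
have Nx : N x != 0 by rewrite gt_eqF// is_norm_gt0.
have Sx : (usphere N `*` Q) ((N x)^-1 *: x, q).
  by split => //; exact: normalize_usphere.
have cphi : ((N y)^-1 *: y, q) @[y --> nbhs x] --> ((N x)^-1 *: x, q).
  have cu : (N y)^-1 *: y @[y --> nbhs x] --> (N x)^-1 *: x.
    apply: (@cvgZ _ _ _ (nbhs x)); last exact: cvg_id.
    by apply: (@cvgV _ _ (nbhs x)) => //; exact: is_norm_continuous.
  have cq : q @[_ --> nbhs x] --> nbhs q by exact: cvg_cst.
  exact: cvg_pair cu cq.
rewrite /prop_for /continuous_at.
move=> A gA; have h1 := cphi _ (cg _ Sx A gA).
apply: (@filterS2 _ (nbhs x) _ _ _ _ _ h1 (near_neq0 x0)) => y /= h y0.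
by apply: h; split => //=; exact: normalize_usphere.
Qed.

(** Subspaces whose minimum nearly reaches the supremum lie in closed superlevel
    cones of [g]. These cones shrink as the level tends to the supremum, so
    [subspace_in_closed_bigcap] gives one subspace inside all of them, and this
    one attains the supremum. *)
Lemma best_lower_subspace (R : realType) (n k : nat) (N : 'cV[R]_n -> R)
  (Q : set (R * R)) (g : 'cV[R]_n * (R * R) -> R) :
  is_norm N -> compact Q -> Q !=set0 -> {within usphere N `*` Q, continuous g} ->
  (0 < k <= n)%N ->
  exists2 X0 : {vspace 'cV[R]_n}, \dim X0 = k &
    forall X : {vspace 'cV[R]_n}, \dim X = k ->
      minimum (values_on N Q g X) <= minimum (values_on N Q g X0).
Proof.
move=> hN cQ Q0 cg /andP[k0 kn].
pose E := [set minimum (values_on N Q g X) | X in Gr R n k].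
have minP (X : {vspace 'cV[R]_n}) := @values_on_minimumP _ _ _ _ _ X hN cQ Q0 cg.
have supE : has_sup E.
  split.
    have [|A [/frame_range_dim h _]] := @orthonormal_frame_sub R n fullv k.
      by rewrite dimvf /dim /= muln1.
    by eexists; exists (limg (linfun (mulmx A : 'cV[R]_k -> 'cV[R]_n))).
  have n0 : (0 < \dim (fullv : {vspace 'cV[R]_n}))%N.
    by rewrite dimvf /dim /= muln1 (leq_trans k0).
  have [_ ub] := values_on_maximumP hN cQ Q0 cg n0.
  exists (maximum (values_on N Q g fullv)) => _ [X Xk <-].
  apply: ub; have [|[p [[_ Np] Qp] gp] _] := minP X; first by rewrite Xk.
  by exists p => //; split => //; split => //=; exact: memvf.
(* The disjunct x = 0 is what makes the superlevel cone closed. *)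
pose C (j : nat) := [set x : 'cV[R]_n | forall q, Q q ->
  x = 0 \/ sup E - j.+1%:R^-1 <= g ((N x)^-1 *: x, q)].
have [|||X0 X0k X0C] := @subspace_in_closed_bigcap R n k C.
- move=> j x clx q Qq; have [->|x0] := eqVneq x 0; [by left|right].
  rewrite leNgt; apply/negP => lt_g.
  have := normalized_value_continuous hN cg Qq x0.
  move=> /(@cvgr_lt _ _ (nbhs x) _ _ _) /(_ _ lt_g) near_lt.
  have [y [Cy [y0]]] := clx _ (filterI (near_neq0 x0) near_lt).
  have [/eqP|] := Cy q Qq; first by rewrite (negbTE y0).
  by rewrite leNgt => /negbTE ->.
- move=> i j ij x Cx q Qq; have [|h] := Cx q Qq; [by left|right].
  by apply: le_trans h; rewrite lerB// lef_pV2 ?posrE// ler_nat.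
- move=> j; have j0 : 0 < j.+1%:R^-1 :> R by rewrite invr_gt0.
  have [_ [X Xk <-] /ltW Xj] := sup_adherent j0 supE.
  exists X => // x xX q Qq; have [->|x0] := eqVneq x 0; [by left|right].
  apply: le_trans Xj _; have [|_ lb] := minP X; first by rewrite Xk.
  apply: lb; exists ((N x)^-1 *: x, q) => //; split => //; split => /=.
    by rewrite memvZ.
  exact: normalize_usphere.
exists X0 => // X Xk; apply: (@le_trans _ _ (sup E)).
  by apply: ub_le_sup; [case: supE|exists X].
have [|[[x q] [[/= xX0 Nx] Qq] <-] _] := minP X0; first by rewrite X0k.
apply/ler_addgt0Pr => e e0.
have [j _ je] : \forall j \near \oo, j.+1%:R^-1 < e.
  by have := @near_infty_natSinv_lt R (PosNum e0).
have [x0|] := X0C j x xX0 q Qq; first by move: (usphere_neq0 hN Nx); rewrite x0 eqxx.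
rewrite Nx invr1 scale1r lerBlDr => h; apply: le_trans h _.
by rewrite lerD2l ltW// je//=.
Qed.

Lemma best_upper_subspace (R : realType) (n k : nat) (N : 'cV[R]_n -> R)
  (Q : set (R * R)) (g : 'cV[R]_n * (R * R) -> R) :
  is_norm N -> compact Q -> Q !=set0 -> {within usphere N `*` Q, continuous g} ->
  (0 < k <= n)%N ->
  exists2 X0 : {vspace 'cV[R]_n}, \dim X0 = k &
    forall X : {vspace 'cV[R]_n}, \dim X = k ->
      maximum (values_on N Q g X0) <= maximum (values_on N Q g X).
Proof.
move=> hN cQ Q0 cg kn.
have cNg : {within usphere N `*` Q, continuous (fun p => - g p)}.
  by move=> p; apply: continuousN; exact: cg.
have [X0 X0k X0max] := best_lower_subspace hN cQ Q0 cNg kn.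
by exists X0 => // X Xk; have := X0max X Xk; rewrite !minimum_values_on_opp lerN2.
Qed.

(** * Splittings and the spectral gap *)

(** The dichotomy condition freed of extremal rates, which makes its behaviour
    under shifts and perturbations of [g] visible pointwise. *)
Definition splitting (R : realType) (n : nat) (N : 'cV[R]_n -> R)
  (Q : set (R * R)) (g : 'cV[R]_n * (R * R) -> R) (gamma : R) : Prop :=
  exists X Y : {vspace 'cV[R]_n},
    [/\ (\dim X + \dim Y = n)%N,
        forall x q, x \in X -> usphere N x -> Q q -> g (x, q) < gamma
      & forall y q, y \in Y -> usphere N y -> Q q -> gamma < g (y, q)].

Lemma splitting_opp (R : realType) (n : nat) (N : 'cV[R]_n -> R)
  (Q : set (R * R)) (g : 'cV[R]_n * (R * R) -> R) (gamma : R) :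
  splitting N Q g gamma -> splitting N Q (fun p => - g p) (- gamma).
Proof.
move=> [X [Y [XY gX gY]]]; exists Y, X; split; first by rewrite addnC.
  by move=> y q ? ? ?; rewrite ltrN2; exact: gY.
by move=> x q ? ? ?; rewrite ltrN2; exact: gX.
Qed.

Lemma vspace_meet (R : realType) (n : nat) (N : 'cV[R]_n -> R) (X Y : {vspace 'cV[R]_n}) :
  is_norm N -> (n < \dim X + \dim Y)%N ->
  exists x, [/\ x \in X, x \in Y & usphere N x].
Proof.
move=> hN nXY; have : vpick (X :&: Y)%VS != 0.
  rewrite vpick0 -dimv_eq0 -lt0n.
  have := dimvS (subvf (X + Y)%VS); rewrite dimvf /dim /= muln1 => h.
  by rewrite -(ltn_add2l (\dim (X + Y))) addn0 dimv_sum_cap (leq_ltn_trans h).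
have /memv_capP[vX vY] := memv_pick (X :&: Y)%VS.
set v := vpick _ in vX vY * => v0.
by exists ((N v)^-1 *: v); split; [exact: memvZ|exact: memvZ|exact: normalize_usphere].
Qed.

(** Suppose that [X] and [Y] split at the extremal value of [X0]. If [X] is at
    least as large as [X0], a subspace of [X] of the dimension of [X0] beats the optimal [X0]; otherwise [X0] and [Y]
    are too large to be disjoint, and a common unit vector has growth both at
    most and above that value. *)
Lemma best_upper_no_splitting (R : realType) (n : nat) (N : 'cV[R]_n -> R)
  (Q : set (R * R)) (g : 'cV[R]_n * (R * R) -> R) (X0 : {vspace 'cV[R]_n}) :
  is_norm N -> compact Q -> Q !=set0 -> {within usphere N `*` Q, continuous g} ->
  (0 < \dim X0)%N ->
  (forall X : {vspace 'cV[R]_n}, \dim X = \dim X0 ->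
      maximum (values_on N Q g X0) <= maximum (values_on N Q g X)) ->
  ~ splitting N Q g (maximum (values_on N Q g X0)).
Proof.
move=> hN cQ Q0 cg X0_gt0 X0best [X [Y [XYn gX gY]]].
have [X0X|XX0] := leqP (\dim X0) (\dim X).
  have [A [/frame_range_dim AX0 AX]] := orthonormal_frame_sub X0X.
  have [] := @values_on_maximumP _ _ N Q g
     (limg (linfun (mulmx A : 'cV[R]_(\dim X0) -> 'cV[R]_n))) hN cQ Q0 cg.
    by rewrite AX0.
  move=> [[x q] [[/= /memv_imgP[c _ xE] Nx] Qq] gmax] _.
  have xX : x \in X by rewrite xE lfunE /=; exact: AX.
  have := gX x q xX Nx Qq; rewrite gmax ltNge => /negP; apply.
  exact: X0best AX0.
have [|x [xX0 xY Nx]] := @vspace_meet _ _ N X0 Y hN.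
  by rewrite -[ltnLHS]XYn ltn_add2r.
have [q Qq] := Q0; have := gY x q xY Nx Qq.
rewrite ltNge => /negP; apply.
have [_ ub] := values_on_maximumP hN cQ Q0 cg X0_gt0.
by apply: ub; exists (x, q).
Qed.

Lemma best_lower_no_splitting (R : realType) (n : nat) (N : 'cV[R]_n -> R)
  (Q : set (R * R)) (g : 'cV[R]_n * (R * R) -> R) (X0 : {vspace 'cV[R]_n}) :
  is_norm N -> compact Q -> Q !=set0 -> {within usphere N `*` Q, continuous g} ->
  (0 < \dim X0)%N ->
  (forall X : {vspace 'cV[R]_n}, \dim X = \dim X0 ->
      minimum (values_on N Q g X) <= minimum (values_on N Q g X0)) ->
  ~ splitting N Q g (minimum (values_on N Q g X0)).
Proof.
move=> hN cQ Q0 cg X0_gt0 X0best /splitting_opp.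
rewrite -maximum_oppE -values_on_opp; apply: best_upper_no_splitting => //.
  by move=> p; apply: continuousN; exact: cg.
by move=> X XX0; rewrite !values_on_opp !maximum_oppE lerN2 X0best.
Qed.

Lemma dim0_usphere (R : realType) (n : nat) (N : 'cV[R]_n -> R)
  (Z : {vspace 'cV[R]_n}) x :
  is_norm N -> \dim Z = 0%N -> x \in Z -> ~ usphere N x.
Proof.
move=> hN /eqP; rewrite dimv_eq0 => /eqP -> /[!memv0] /eqP -> /(usphere_neq0 hN).
by rewrite eqxx.
Qed.

(** Replace [X] and [Y] by optimal subspaces of the same dimensions. Their
    extremal rates [- d < 0 < c] bound an interval of splitting values whose
    endpoints do not split, so [theta] is the smaller of [c] and [d]; when one
    of the subspaces is trivial, only the rate of the other one exists, and it
    does since [n > 0]. *)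
Lemma splitting_gap (R : realType) (n : nat) (N : 'cV[R]_n -> R)
  (Q : set (R * R)) (g : 'cV[R]_n * (R * R) -> R) :
  is_norm N -> compact Q -> Q !=set0 -> {within usphere N `*` Q, continuous g} ->
  (0 < n)%N -> splitting N Q g 0 ->
  exists (X Y : {vspace 'cV[R]_n}) (theta : R),
    [/\ 0 < theta, (\dim X + \dim Y = n)%N,
        forall x q, x \in X -> usphere N x -> Q q -> g (x, q) <= - theta,
        forall y q, y \in Y -> usphere N y -> Q q -> theta <= g (y, q)
      & ~ splitting N Q g theta \/ ~ splitting N Q g (- theta)].
Proof.
move=> hN cQ Q0 cg n0 [X [Y [XYn gX gY]]].
have upperP : \dim X = 0%N \/ exists X0 d, [/\ 0 < d, \dim X0 = \dim X,
    forall x q, x \in X0 -> usphere N x -> Q q -> g (x, q) <= - d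
    & ~ splitting N Q g (- d)].
  have [X_0|X_gt0] := posnP (\dim X); [by left|right].
  have [|X0 X0X X0best] := best_upper_subspace hN cQ Q0 cg (k := \dim X).
    by rewrite X_gt0 -[leqRHS]XYn leq_addr.
  exists X0, (- maximum (values_on N Q g X0)); rewrite !opprK; split => //.
  - rewrite oppr_gt0; apply: le_lt_trans (X0best X erefl) _.
    by have [[[x q] [[/= ? ?] ?] <-] _] := values_on_maximumP hN cQ Q0 cg X_gt0; exact: gX.
  - move=> x q xX0 Nx Qq; rewrite -X0X in X_gt0.
    by have [_ ub] := values_on_maximumP hN cQ Q0 cg X_gt0; apply: ub; exists (x, q).
  - by apply: best_upper_no_splitting => //; rewrite X0X.
have lowerP : \dim Y = 0%N \/ exists Y0 c, [/\ 0 < c, \dim Y0 = \dim Y,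
    forall y q, y \in Y0 -> usphere N y -> Q q -> c <= g (y, q)
    & ~ splitting N Q g c].
  have [Y_0|Y_gt0] := posnP (\dim Y); [by left|right].
  have [|Y0 Y0Y Y0best] := best_lower_subspace hN cQ Q0 cg (k := \dim Y).
    by rewrite Y_gt0 -[leqRHS]XYn leq_addl.
  exists Y0, (minimum (values_on N Q g Y0)); split => //.
  - apply: lt_le_trans (Y0best Y erefl).
    by have [[[x q] [[/= ? ?] ?] <-] _] := values_on_minimumP hN cQ Q0 cg Y_gt0; exact: gY.
  - move=> x q xY0 Nx Qq; rewrite -Y0Y in Y_gt0.
    by have [_ lb] := values_on_minimumP hN cQ Q0 cg Y_gt0; apply: lb; exists (x, q).
  - by apply: best_lower_no_splitting => //; rewrite Y0Y.
case: upperP lowerP => [X_0|[X0 [d [d0 X0X gX0 nd]]]] [Y_0|[Y0 [c [c0 Y0Y gY0 nc]]]].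
- by move: n0; rewrite -[ltnRHS]XYn X_0 Y_0.
- exists X, Y0, c; split => //; [by rewrite Y0Y| |by left].
  by move=> x q xX Nx; case: (dim0_usphere hN X_0 xX Nx).
- exists X0, Y, d; split => //; [by rewrite X0X| |by right].
  by move=> y q yY Ny; case: (dim0_usphere hN Y_0 yY Ny).
- have [cd|dc] := leP c d.
  + exists X0, Y0, c; split => //; [by rewrite X0X Y0Y| |by left].
    by move=> x q xX Nx Qq; apply: le_trans (gX0 x q xX Nx Qq) _; rewrite lerN2.
  + exists X0, Y0, d; split => //; [by rewrite X0X Y0Y| |by right].
    by move=> x q xX Nx Qq; apply: le_trans (gY0 x q xX Nx Qq); exact: ltW.
Qed.

(** * Growth extensions and shifted processes *)

Lemma compact_minimum_in (R : realType) (I : set R) :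
  compact I -> I !=set0 -> I (minimum I).
Proof.
move=> cI I0; have [] := @compact_EVT_min _ _ id I I0 cI.
  by apply: (@continuous_subspaceT _ _ I id) => x; exact: cvg_id.
move=> c; rewrite inE => Ic cmin; rewrite (@minimumE _ I c)// => t It.
by apply: cmin; rewrite inE.
Qed.

Lemma compact_maximum_in (R : realType) (I : set R) :
  compact I -> I !=set0 -> I (maximum I).
Proof.
move=> cI I0; have [] := @compact_EVT_max _ _ id I I0 cI.
  by apply: (@continuous_subspaceT _ _ I id) => x; exact: cvg_id.
move=> c; rewrite inE => Ic cmax; rewrite (@maximumE _ I c)// => t It.
by apply: cmax; rewrite inE.
Qed.

Lemma nontrivial_neq0 (R : realType) (I : set R) :
  minimum I < maximum I -> I !=set0.
Proof.
move=> mM; apply/set0P/eqP => I0; move: mM.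
rewrite /minimum /maximum !xgetPN ?ltxx//= I0.
- by move=> x [].
- by move=> x [].
Qed.

Lemma offdiag_closure_neq0 (R : realType) (I : set R) :
  compact I -> minimum I < maximum I -> closure (offdiag I) !=set0.
Proof.
move=> cI mM; have I0 := nontrivial_neq0 mM.
exists (minimum I, maximum I); apply: subset_closure; split => /=.
- exact: compact_minimum_in.
- exact: compact_maximum_in.
- by move=> e; rewrite e ltxx in mM.
Qed.

Lemma offdiag_closure_compact (R : realType) (I : set R) :
  compact I -> compact (closure (offdiag I)).
Proof.
move=> cI; have cII := compact_setX cI cI.
apply: (subclosed_compact (@closed_closure _ _) cII).
have clII : closed (I `*` I) by apply: compact_closed cII; exact: norm_hausdorff.
rewrite ((closure_id _).1 clII); apply: closureS.
by move=> [t s] [].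
Qed.

Lemma ext_growthP (R : realType) (n : nat) (N : 'cV[R]_n -> R) (I : set R) Phi :
  LP N I Phi -> growth_extension N I Phi (ext_growth N I Phi).
Proof.
move=> [_ [g gP]]; rewrite /ext_growth.
exact: (@xgetPex _ (fun=> 0) [set g | growth_extension N I Phi g] (ex_intro _ g gP)).
Qed.

(** The off-diagonal is dense in its closure, and the difference of the two
    extensions vanishes there. This is what allows the chosen extension of a
    shifted process to be computed. *)
Lemma growth_extension_unique (R : realType) (n : nat) (N : 'cV[R]_n -> R)
  (I : set R) Phi g h p :
  growth_extension N I Phi g -> growth_extension N I Phi h ->
  (usphere N `*` closure (offdiag I)) p -> g p = h p.
Proof.
move=> [cg gE] [ch hE] Dp; apply: contrapT => /eqP gh.
have /subspace_continuousP cgh :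
    {within usphere N `*` closure (offdiag I), continuous (fun p => g p - h p)}.
  by move=> z; apply: continuousB; [exact: cg|exact: ch].
have ghp : g p - h p != 0 by rewrite subr_eq0.
have := @cvgr_neq0 _ _ _ (within (usphere N `*` closure (offdiag I)) (nbhs p)) _ _ _
   (cgh p Dp) ghp.
case: p Dp {gh ghp} => x q [/= Nx Qq] [[A B] /= [Ax Bq] AB].
have [r [Dr Br]] := Qq _ Bq.
have := AB (x, r); rewrite /= /from_subspace gE// hE// subrr eqxx.
move=> h'; have : is_true false; last by [].
apply: h'; first by split => //=; exact: nbhs_singleton Ax.
by split => //=; exact: subset_closure.
Qed.

(** The factor [expR (- gamma * (t - s))] becomes an additive term linear in
    time under the logarithm, whose difference quotient is [- gamma]. *)
Lemma growth_shifted (R : realType) (n : nat) (N : 'cV[R]_n -> R) (I : set R)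
  Phi gamma p : is_norm N -> compact I -> linear_process N I Phi ->
  (usphere N `*` offdiag I) p ->
  growth N I (shifted gamma Phi) p = growth N I Phi p - gamma.
Proof.
move=> hN cI [unitPhi _ _ _ _]; case: p => x [t s] [/= Nx [/= It Is ts]].
have Im : I (minimum I) by apply: compact_minimum_in => //; exists t.
have pos r : I r -> 0 < N (Phi r (minimum I) *m x).
  move=> Ir; apply: is_norm_gt0 => //; apply: contra (usphere_neq0 hN Nx) => /eqP h.
  by rewrite -(mulKmx (unitPhi _ _ Ir Im) x) h mulmx0.
have lnE r : I r -> ln (N (shifted gamma Phi r (minimum I) *m x)) =
    - gamma * (r - minimum I) + ln (N (Phi r (minimum I) *m x)).
  move=> Ir; rewrite /shifted -scalemxAl (is_normZ hN) ger0_norm ?expR_ge0//.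
  by rewrite lnM ?posrE ?expR_gt0 ?pos// expRK.
rewrite /growth /log_quotient /= !lnE//.
have : t - s != 0 by rewrite subr_eq0; apply/eqP.
by move=> ts0; field.
Qed.

(** Follows from [1 + x <= expR x] at [x = v - u], multiplied by [expR u]. *)
Lemma expR_lipschitz (R : realType) (u v E : R) :
  expR u <= E -> expR v <= E -> `|expR u - expR v| <= E * `|u - v|.
Proof.
wlog vu : u v / v <= u.
  move=> h uE vE; have [/h|/ltW/h] := leP v u; first by apply.
  by rewrite distrC [`|u - v|]distrC; apply.
move=> uE _; rewrite !ger0_norm ?subr_ge0 ?ler_expR//.
have := expR_ge1Dx (v - u); rewrite -(ler_pM2l (expR_gt0 u)) -expRD => h.
have : expR u * (u - v) <= E * (u - v) by rewrite ler_wpM2r// subr_ge0.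
by move: h; rewrite (_ : u + (v - u) = v); [nra|ring].
Qed.

(** Only the Lipschitz condition takes work: the difference of the two products
    splits into a part where [Phi] varies and a part where the exponential
    varies, and all factors are bounded since [I] is. *)
Lemma shifted_linear_process (R : realType) (n : nat) (N : 'cV[R]_n -> R)
  (I : set R) Phi gamma : (0 < n)%N -> is_norm N -> compact I ->
  linear_process N I Phi -> linear_process N I (shifted gamma Phi).
Proof.
move=> n0 hN cI [unitPhi contPhi id_Phi PhiM lipPhi]; split.
- move=> t s It Is; rewrite /shifted unitmxZ ?unitPhi//.
  by rewrite unitfE gt_eqF// expR_gt0.
- have -> : (fun p : (R * R) * 'cV[R]_n =>
      shifted gamma Phi p.1.1 p.1.2 *m p.2 : 'cV[R]_n) =
      (fun p => expR (- gamma * (p.1.1 - p.1.2)) *: (Phi p.1.1 p.1.2 *m p.2)).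
    by apply/funext => p; rewrite /shifted -scalemxAl.
  apply/subspace_continuousP => p Dp.
  apply: (@cvgZ _ _ _ (within ((I `*` I) `*` [set: 'cV[R]_n]) (nbhs p))).
    apply: cvg_within_filter.
    apply: (@continuous_comp _ _ _
      (fun p : (R * R) * 'cV[R]_n => - gamma * (p.1.1 - p.1.2)) expR);
      last exact: continuous_expR.
    apply: (@cvgM _ _ (nbhs p)); first exact: cvg_cst.
    apply: (@cvgB _ _ _ (nbhs p)).
      apply: (@continuous_comp _ _ _ (fun p : (R * R) * 'cV[R]_n => p.1) fst);
        exact: cvg_fst.
    apply: (@continuous_comp _ _ _ (fun p : (R * R) * 'cV[R]_n => p.1) snd);
      [exact: cvg_fst|exact: cvg_snd].
  by move/subspace_continuousP: contPhi; apply.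
- by move=> t It; rewrite /shifted subrr mulr0 expR0 scale1r id_Phi.
- move=> t s r It Is Ir; rewrite /shifted -scalemxAl -scalemxAr scalerA -expRD PhiM//.
  by congr (expR _ *: _); ring.
move=> s Is; have [L lipL] := lipPhi s Is.
have [B [_ IB']] := compact_bounded cI.
have IB t : I t -> `|t| <= `|B| + 1.
  by move=> It; apply: (IB' (`|B| + 1)) => //; rewrite (le_lt_trans (ler_norm _))// ltrDl.
pose D := 2 * (`|B| + 1).
have ID t : I t -> `|t - s| <= D.
  move=> It; apply: le_trans (ler_normB _ _) _.
  by rewrite /D mulr_natl mulr2n lerD// IB.
pose E := expR (`|gamma| * D).
have expE t : I t -> expR (- gamma * (t - s)) <= E.
  move=> It; rewrite ler_expR; apply: le_trans (ler_norm _) _.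
  by rewrite normrM normrN ler_wpM2l// ID.
have E0 : 0 <= E by exact: expR_ge0.
exists (E * `|L| + E * `|gamma| * (`|L| * D + 1)) => t t' It It'.
apply: opnorm_le.
  exists ((N (const_mx 1))^-1 *: const_mx 1); apply: normalize_usphere => //.
  apply/eqP => /matrixP/(_ (Ordinal n0) 0); rewrite !mxE => /eqP.
  by rewrite oner_eq0.
move=> x Nx.
have NL r r' : I r -> I r' -> N ((Phi r s - Phi r' s) *m x) <= `|L| * `|r - r'|.
  move=> Ir Ir'; apply: le_trans (opnorm_ub _ hN Nx) _.
  by apply: le_trans (lipL _ _ Ir Ir') _; rewrite ler_wpM2r// ler_norm.
have NPhi : N (Phi t' s *m x) <= `|L| * D + 1.
  have -> : Phi t' s *m x = (Phi t' s - Phi s s) *m x + x.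
    by rewrite id_Phi// mulmxBl mul1mx subrK.
  apply: le_trans (is_normD hN _ _) _; rewrite Nx lerD2r.
  by apply: le_trans (NL _ _ It' Is) _; rewrite ler_wpM2l// ID.
have -> : (shifted gamma Phi t s - shifted gamma Phi t' s) *m x =
    expR (- gamma * (t - s)) *: ((Phi t s - Phi t' s) *m x) +
    (expR (- gamma * (t - s)) - expR (- gamma * (t' - s))) *: (Phi t' s *m x).
  rewrite /shifted !mulmxBl -!scalemxAl scalerBr scalerBl addrA.
  by rewrite addrNK.
apply: le_trans (is_normD hN _ _) _; rewrite !(is_normZ hN) mulrDl lerD//.
  by rewrite -mulrA ler_pM ?normr_ge0 ?is_norm_ge0 ?NL// ger0_norm ?expR_ge0 ?expE.
have := expR_lipschitz (expE _ It) (expE _ It').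
rewrite -mulrBr (_ : t - s - (t' - s) = t - t'); last by ring.
rewrite normrM normrN => h.
rewrite mulrAC; apply: ler_pM; rewrite ?normr_ge0 ?is_norm_ge0//.
by rewrite -mulrA.
Qed.

Lemma shifted_growth_extension (R : realType) (n : nat) (N : 'cV[R]_n -> R)
  (I : set R) Phi gamma g : is_norm N -> compact I -> linear_process N I Phi ->
  growth_extension N I Phi g ->
  growth_extension N I (shifted gamma Phi) (fun p => g p - gamma).
Proof.
move=> hN cI lPhi [cg gE]; split.
  exact: (within_continuousB cg (continuous_subspaceT (fun=> cvg_cst gamma))).
by move=> p Dp; rewrite gE// growth_shifted.
Qed.

Lemma shifted_LP (R : realType) (n : nat) (N : 'cV[R]_n -> R) (I : set R) Phi gamma :
  (0 < n)%N -> is_norm N -> compact I -> LP N I Phi -> LP N I (shifted gamma Phi).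
Proof.
move=> n0 hN cI [lPhi [g gP]]; split; first exact: shifted_linear_process.
by exists (fun p => g p - gamma); exact: shifted_growth_extension.
Qed.

Lemma ext_growth_shifted (R : realType) (n : nat) (N : 'cV[R]_n -> R) (I : set R)
  Phi gamma p :
  (0 < n)%N -> is_norm N -> compact I -> LP N I Phi ->
  (usphere N `*` closure (offdiag I)) p ->
  ext_growth N I (shifted gamma Phi) p = ext_growth N I Phi p - gamma.
Proof.
move=> n0 hN cI hPhi Dp; have [lPhi _] := hPhi.
have gshift := shifted_growth_extension gamma hN cI lPhi (ext_growthP hPhi).
exact: growth_extension_unique (ext_growthP (shifted_LP gamma n0 hN cI hPhi)) gshift Dp.
Qed.

(** * The dichotomy radius *)

(** From left to right the sign of an extremal rate says by itself that it is
    attained, as the default value 0 is excluded. The converse needs attainment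
    of the optimum, that is, compactness of the Grassmannian. *)
Lemma EMD_splitting (R : realType) (n : nat) (N : 'cV[R]_n -> R) (I : set R) Psi :
  is_norm N -> compact I -> minimum I < maximum I -> LP N I Psi ->
  EMD N I Psi <-> splitting N (closure (offdiag I)) (ext_growth N I Psi) 0.
Proof.
move=> hN cI mM hPsi.
have cQ := offdiag_closure_compact cI; have Q0 := offdiag_closure_neq0 cI mM.
set Q := closure (offdiag I) in cQ Q0 *.
have [cg _] := ext_growthP hPsi; set g := ext_growth N I Psi in cg *.
split.
  move=> [k [kn]]; rewrite /upper_rate /lower_rate => upper_lt0 lower_gt0.
  have [X Xk gX] : exists2 X : {vspace 'cV[R]_n}, \dim X = k &
      forall x q, x \in X -> usphere N x -> Q q -> g (x, q) < 0.
    move: upper_lt0; case: posnP => [->|k0].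
      exists 0%VS => [|x q]; first exact: dimv0.
      by rewrite memv0 => /eqP -> /(usphere_neq0 hN); rewrite eqxx.
    rewrite lte_fin /minimum; case: xgetP => [m _ [[X Xk <-] _] m0|];
      last by rewrite ltxx.
    exists X => // x q xX Nx Qq; apply: le_lt_trans m0.
    have [|_ ub] := @values_on_maximumP _ _ _ _ _ X hN cQ Q0 cg; first by rewrite Xk.
    by apply: ub; exists (x, q).
  have [Y Yk gY] : exists2 Y : {vspace 'cV[R]_n}, \dim Y = (n - k)%N &
      forall y q, y \in Y -> usphere N y -> Q q -> 0 < g (y, q).
    move: lower_gt0; case: (posnP (n - k)) => [->|k0].
      exists 0%VS => [|x q]; first exact: dimv0.
      by rewrite memv0 => /eqP -> /(usphere_neq0 hN); rewrite eqxx.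
    rewrite lte_fin /maximum; case: xgetP => [m _ [[Y Yk <-] _] m0|];
      last by rewrite ltxx.
    exists Y => // x q xY Nx Qq; apply: lt_le_trans m0 _.
    have [|_ lb] := @values_on_minimumP _ _ _ _ _ Y hN cQ Q0 cg; first by rewrite Yk.
    by apply: lb; exists (x, q).
  by exists X, Y; split => //; rewrite Xk Yk subnKC.
move=> [X [Y [XYn gX gY]]]; exists (\dim X).
have Yk : \dim Y = (n - \dim X)%N by rewrite -[X in (X - _)%N]XYn addKn.
have Xn : (\dim X <= n)%N by rewrite -[leqRHS]XYn leq_addr.
split => //.
  rewrite /upper_rate; case: posnP => [_|X0]; first exact: ltNy0.
  have [|X1 X1X X1best] := best_upper_subspace hN cQ Q0 cg (k := \dim X).
    by rewrite X0.
  rewrite lte_fin (@minimumE _ _ (upper_growth N I Psi X1)); last 2 first.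
  - by exists X1.
  - by move=> _ [Z Zk <-]; exact: X1best.
  apply: le_lt_trans (X1best X erefl) _.
  by have [[[x q] [[/= ? ?] ?] <-] _] := values_on_maximumP hN cQ Q0 cg X0; exact: gX.
rewrite /lower_rate -Yk; case: posnP => [_|Y0]; first exact: lt0y.
have [|Y1 Y1Y Y1best] := best_lower_subspace hN cQ Q0 cg (k := \dim Y).
  by rewrite Y0 Yk leq_subr.
rewrite lte_fin (@maximumE _ _ (lower_growth N I Psi Y1)); last 2 first.
- by exists Y1.
- by move=> _ [Z Zk <-]; exact: Y1best.
apply: lt_le_trans (Y1best Y erefl).
by have [[[x q] [[/= ? ?] ?] <-] _] := values_on_minimumP hN cQ Q0 cg Y0; exact: gY.
Qed.

Lemma spectrumP (R : realType) (n : nat) (N : 'cV[R]_n -> R) (I : set R) Phi gamma :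
  (0 < n)%N -> is_norm N -> compact I -> minimum I < maximum I -> LP N I Phi ->
  spectrum N I Phi gamma <->
  ~ splitting N (closure (offdiag I)) (ext_growth N I Phi) gamma.
Proof.
move=> n0 hN cI mM hPhi; rewrite /spectrum /=.
have shE x q : usphere N x -> closure (offdiag I) q ->
    ext_growth N I (shifted gamma Phi) (x, q) = ext_growth N I Phi (x, q) - gamma.
  by move=> Nx Qq; apply: ext_growth_shifted.
have := EMD_splitting hN cI mM (shifted_LP gamma n0 hN cI hPhi).
suff -> : splitting N (closure (offdiag I)) (ext_growth N I (shifted gamma Phi)) 0 <->
    splitting N (closure (offdiag I)) (ext_growth N I Phi) gamma by tauto.
split=> -[X [Y [XYn gX gY]]]; exists X, Y; split => //.
- by move=> x q xX Nx Qq; have := gX x q xX Nx Qq; rewrite shE// subr_lt0.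
- by move=> x q xY Nx Qq; have := gY x q xY Nx Qq; rewrite shE// subr_gt0.
- by move=> x q xX Nx Qq; rewrite shE// subr_lt0 gX.
- by move=> x q xY Nx Qq; rewrite shE// subr_gt0 gY.
Qed.

Lemma semidist_shifted (R : realType) (n : nat) (N : 'cV[R]_n -> R) (I : set R)
  Phi gamma :
  (0 < n)%N -> is_norm N -> compact I -> minimum I < maximum I -> LP N I Phi ->
  (semidist N I Phi (shifted gamma Phi) <= `|gamma|%:E)%E.
Proof.
move=> n0 hN cI mM hPhi.
have cQ := offdiag_closure_compact cI; have Q0 := offdiag_closure_neq0 cI mM.
have [cg _] := ext_growthP hPhi.
apply: ge_ereal_sup => _ [X X1 <-]; rewrite lee_fin.
have X0 : (0 < \dim X)%N by rewrite X1.
have VE : growth_values N I (shifted gamma Phi) X =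
    [set y - gamma | y in growth_values N I Phi X].
  rewrite /growth_values image_comp; apply: eq_imagel => -[x q] [[/= _ Nx] Qq].
  by rewrite ext_growth_shifted.
have [Vmin lb] := values_on_minimumP hN cQ Q0 cg X0.
have [Vmax ub] := values_on_maximumP hN cQ Q0 cg X0.
have -> : lower_growth N I (shifted gamma Phi) X = lower_growth N I Phi X - gamma.
  rewrite /lower_growth VE; apply: minimumE; first by exists (lower_growth N I Phi X).
  by move=> _ [y Vy <-]; rewrite lerD2r; exact: lb.
have -> : upper_growth N I (shifted gamma Phi) X = upper_growth N I Phi X - gamma.
  rewrite /upper_growth VE; apply: maximumE; first by exists (upper_growth N I Phi X).
  by move=> _ [y Vy <-]; rewrite lerD2r; exact: ub.
by rewrite !subKr maxxx.
Qed.

Lemma edist_realE (R : realType) (x y : R) : edist (x, y) = `|x - y|%:E.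
Proof.
apply/eqP; rewrite eq_le; apply/andP; split.
  apply/lee_addgt0Pr => e e0; rewrite -EFinD; apply: edist_fin.
    by rewrite ltr_wpDl.
  by rewrite /= /ball /= ltrDl.
rewrite leNgt; apply/negP => /edist_lt_ball.
by rewrite /ball /= ltxx.
Qed.

Lemma upper_growth_ge (R : realType) (n : nat) (N : 'cV[R]_n -> R) (I : set R) Psi
  (X : {vspace 'cV[R]_n}) x q :
  is_norm N -> compact I -> minimum I < maximum I -> LP N I Psi ->
  x \in X -> usphere N x -> closure (offdiag I) q ->
  ext_growth N I Psi (x, q) <= upper_growth N I Psi X.
Proof.
move=> hN cI mM hPsi xX Nx Qq; have [cg _] := ext_growthP hPsi.
have X0 : (0 < \dim X)%N.
  by rewrite lt0n; apply/eqP => X0; exact: (dim0_usphere hN X0 xX Nx).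
have [_ ub] := values_on_maximumP hN (offdiag_closure_compact cI)
  (offdiag_closure_neq0 cI mM) cg X0.
apply: ub; exists (x, q); last exact: erefl.
by split; [split; [exact: xX|exact: Nx]|exact: Qq].
Qed.

Lemma upper_growth_le (R : realType) (n : nat) (N : 'cV[R]_n -> R) (I : set R) Psi
  (X : {vspace 'cV[R]_n}) a :
  is_norm N -> compact I -> minimum I < maximum I -> LP N I Psi -> (0 < \dim X)%N ->
  (forall x q, x \in X -> usphere N x -> closure (offdiag I) q ->
     ext_growth N I Psi (x, q) <= a) ->
  upper_growth N I Psi X <= a.
Proof.
move=> hN cI mM hPsi X0 ga; have [cg _] := ext_growthP hPsi.
have [[[x q] [[xX Nx] Qq] gx] _] := values_on_maximumP hN
  (offdiag_closure_compact cI) (offdiag_closure_neq0 cI mM) cg X0.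
rewrite (_ : upper_growth N I Psi X = ext_growth N I Psi (x, q)); last exact: esym gx.
exact: ga xX Nx Qq.
Qed.

Lemma lower_growth_le (R : realType) (n : nat) (N : 'cV[R]_n -> R) (I : set R) Psi
  (X : {vspace 'cV[R]_n}) x q :
  is_norm N -> compact I -> minimum I < maximum I -> LP N I Psi ->
  x \in X -> usphere N x -> closure (offdiag I) q ->
  lower_growth N I Psi X <= ext_growth N I Psi (x, q).
Proof.
move=> hN cI mM hPsi xX Nx Qq; have [cg _] := ext_growthP hPsi.
have X0 : (0 < \dim X)%N.
  by rewrite lt0n; apply/eqP => X0; exact: (dim0_usphere hN X0 xX Nx).
have [_ lb] := values_on_minimumP hN (offdiag_closure_compact cI)
  (offdiag_closure_neq0 cI mM) cg X0.
apply: lb; exists (x, q); last exact: erefl.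
by split; [split; [exact: xX|exact: Nx]|exact: Qq].
Qed.

Lemma lower_growth_ge (R : realType) (n : nat) (N : 'cV[R]_n -> R) (I : set R) Psi
  (X : {vspace 'cV[R]_n}) a :
  is_norm N -> compact I -> minimum I < maximum I -> LP N I Psi -> (0 < \dim X)%N ->
  (forall x q, x \in X -> usphere N x -> closure (offdiag I) q ->
     a <= ext_growth N I Psi (x, q)) ->
  a <= lower_growth N I Psi X.
Proof.
move=> hN cI mM hPsi X0 ga; have [cg _] := ext_growthP hPsi.
have [[[x q] [[xX Nx] Qq] gx] _] := values_on_minimumP hN
  (offdiag_closure_compact cI) (offdiag_closure_neq0 cI mM) cg X0.
rewrite (_ : lower_growth N I Psi X = ext_growth N I Psi (x, q)); last exact: esym gx.
exact: ga xX Nx Qq.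
Qed.

(** The semimetric controls both rates of the line through each unit vector, and
    the rates of such a line bound the growth of [Psi] along that vector. *)
Lemma splitting_perturbation (R : realType) (n : nat) (N : 'cV[R]_n -> R) (I : set R)
  Phi Psi (X Y : {vspace 'cV[R]_n}) theta :
  is_norm N -> compact I -> minimum I < maximum I -> LP N I Phi -> LP N I Psi ->
  (\dim X + \dim Y = n)%N ->
  (forall x q, x \in X -> usphere N x -> closure (offdiag I) q ->
     ext_growth N I Phi (x, q) <= - theta) ->
  (forall y q, y \in Y -> usphere N y -> closure (offdiag I) q ->
     theta <= ext_growth N I Phi (y, q)) ->
  (semidist N I Phi Psi < theta%:E)%E ->
  splitting N (closure (offdiag I)) (ext_growth N I Psi) 0.
Proof.
move=> hN cI mM hPhi hPsi XYn gX gY Phi_Psi.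
have dim_line (x : 'cV[R]_n) : usphere N x -> \dim <[x]>%VS = 1%N.
  by move=> Nx; rewrite dim_vline (usphere_neq0 hN Nx).
have line_close (x : 'cV[R]_n) : usphere N x ->
    Num.max `|lower_growth N I Phi <[x]>%VS - lower_growth N I Psi <[x]>%VS|
            `|upper_growth N I Phi <[x]>%VS - upper_growth N I Psi <[x]>%VS| < theta.
  move=> Nx; rewrite -lte_fin; apply: le_lt_trans Phi_Psi.
  apply: ereal_sup_ubound; exists <[x]>%VS; last exact: erefl.
  exact: dim_line Nx.
exists X, Y; split; first exact: XYn.
  move=> x q xX Nx Qq; have := line_close x Nx.
  rewrite gt_max => /andP[_]; rewrite ltr_norml => /andP[+ _].
  have := upper_growth_ge hN cI mM hPsi (memv_line x) Nx Qq.
  have : upper_growth N I Phi <[x]>%VS <= - theta.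
    apply: (upper_growth_le hN cI mM hPhi) => [|z r zx]; first by rewrite dim_line.
    by apply: gX; move: zx => /vlineP[a ->]; exact: memvZ.
  lra.
move=> y q yY Ny Qq; have := line_close y Ny.
rewrite gt_max => /andP[+ _]; rewrite ltr_norml => /andP[_ +].
have := lower_growth_le hN cI mM hPsi (memv_line y) Ny Qq.
have : theta <= lower_growth N I Phi <[y]>%VS.
  apply: (lower_growth_ge hN cI mM hPhi) => [|z r zy]; first by rewrite dim_line.
  by apply: gY; move: zy => /vlineP[a ->]; exact: memvZ.
lra.
Qed.

Unset Implicit Arguments.

Theorem theorem3p12 (R : realType) (n : nat) (n_ge1 : (1 <= n)%N)
  (N : 'cV[R]_n -> R) (N_norm : is_norm N)
  (I : set R) (I_compact : compact I) (I_nontrivial : minimum I < maximum I)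
  (Phi : R -> R -> 'M[R]_n) (Phi_LP : LP N I Phi) (Phi_EMD : EMD N I Phi) :
  exists theta : R,
    [/\ edist_inf (spectrum N I Phi) 0 = theta%:E,
        0 < theta,
        EMD_radius N I Phi theta
      & forall r : R, EMD_radius N I Phi r -> r <= theta].
Proof.
have [cg _] := ext_growthP Phi_LP.
have specP gamma := @spectrumP _ _ _ _ _ gamma n_ge1 N_norm I_compact I_nontrivial Phi_LP.
have /(EMD_splitting N_norm I_compact I_nontrivial Phi_LP) split0 := Phi_EMD.
have [X [Y [theta [theta0 XYn gX gY endpoint]]]] :=
  splitting_gap N_norm (offdiag_closure_compact I_compact)
    (offdiag_closure_neq0 I_compact I_nontrivial) cg n_ge1 split0.
(* A spectral value closest to 0. *)
have [gamma gammaE Sgamma] : exists2 gamma : R, `|gamma| = theta & spectrum N I Phi gamma.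
  case: endpoint => /specP S_endpoint.
    by exists theta; [rewrite gtr0_norm|exact: S_endpoint].
  by exists (- theta); [rewrite normrN gtr0_norm|exact: S_endpoint].
exists theta; split; [|exact: theta0| |].
- apply/eqP; rewrite eq_le; apply/andP; split.
    apply: ereal_inf_lbound; exists gamma; first exact: Sgamma.
    by rewrite edist_realE sub0r normrN gammaE.
  apply: le_ereal_inf_tmp => _ [b Sb <-]; rewrite edist_realE sub0r normrN lee_fin.
  rewrite leNgt; apply/negP; rewrite ltr_norml => /andP[b_gt b_lt].
  apply: ((specP b).1 Sb); exists X, Y; split; first exact: XYn.
    by move=> x q xX Nx Qq; exact: le_lt_trans (gX x q xX Nx Qq) b_gt.
  by move=> y q yY Ny Qq; exact: lt_le_trans b_lt (gY y q yY Ny Qq).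
- move=> Psi Psi_LP Phi_Psi.
  apply: (EMD_splitting N_norm I_compact I_nontrivial Psi_LP).2.
  exact: splitting_perturbation N_norm I_compact I_nontrivial Phi_LP Psi_LP XYn gX gY Phi_Psi.
- move=> r r_radius; rewrite leNgt; apply/negP => theta_r.
  apply: Sgamma; apply: r_radius; first exact: shifted_LP.
  have := semidist_shifted gamma n_ge1 N_norm I_compact I_nontrivial Phi_LP.
  by rewrite gammaE => /le_lt_trans; apply; rewrite lte_fin.
Qed.
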